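(* Let $K,M$ be finite simplicial complexes, let $\phi:K\to M$ be a $k$-fold covering map, and let $i\ge 0$. Let $\psi$ be a permutation assignment on $B_i(M)$ with values in $\mathbb{S}_k$ and $\eta: B_i(M)^\psi\to B_i(K)$ a graph isomorphism with $\phi(\eta(G,j))=G$ for every vertex $(G,j)$ of $B_i(M)^\psi$ (so $\eta$ maps $S_i(M)\times[k]$ onto $S_i(K)$ and $S_{i+1}(M)\times[k]$ onto $S_{i+1}(K)$). Let $$\Psi_i=\langle \psi(G,\bar G): G\in S_i(M),\ \bar G\in S_{i+1}(M),\ G\in\partial\bar G\rangle\le \mathbb{S}_k,$$ let $\varrho:\Psi_i\to \mathrm{GL}_k(\mathbb{C})$, $g\mapsto P^g$, be its permutation representation, and let $T$ be an invertible matrix such that for all $g\in\Psi_i$ $$T^{-1}P^gT=I_1\oplus\varrho_2(g)\oplus\cdots\oplus\varrho_t(g),$$ where $\varrho=\varrho_1\oplus\varrho_2\oplus\cdots\oplus\varrho_t$ is a decomposition into irreducible sub-representations over $\mathbb{C}$ with $\varrho_1=1$ the identity representation of degree one. Suppose that the weight functions satisfy $w_K(F)=w_M(\phi(F))$ for all $F\in K$. Then $$(I\otimes T)^{-1}\Lambda_i(M)^\eta\,\mathcal{L}_i^{\mathrm{up}}(K)\,(\Lambda_i(M)^\eta)^{-1}(I\otimes T)$$ $$=\mathcal{L}_i^{\mathrm{up}}(M)\oplus\bigoplus_{j=2}^t\Big(\sum_{g\in\Psi_i}\big(W_i(M)^{-1}D_i^g(M)^\top\big)\otimes\varrho_j(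g^{-1})\Big)\Big(\sum_{g\in\Psi_i}\big(W_{i+1}(M)D_i^g(M)\big)\otimes\varrho_j(g)\Big).$$
   Context: Complexes. A complex $K$ is a collection of subsets of a finite set closed under inclusion, with $\emptyset\in K$ (dimension $-1$). $S_i(K)$ is the set of $i$-faces (faces with $i+1$ elements), $V(K)$ the vertex set. $K$ is connected if the graph formed by its vertices and $1$-faces is connected. For $\bar F\in S_{i+1}(K)$, $\partial\bar F$ is the set of $i$-faces contained in $\bar F$. Coverings. A simplicial map $\phi:K\to M$ is a map $V(K)\to V(M)$ sending faces to faces; $F\in\phi^{-1}(G)$ means $F\in K$ and $\phi(F)=G$. A covering map (all coverings are strong) is a simplicial map $\phi:K\to M$ such that: $K$ is connected; for each $G\in M$, the vertices of $K$ lying over $G$ are the union of the simplices $F\in\phi^{-1}(G)$, these simplices are pairwise disjoint, and each restriction $\phi|_F:F\to G$ is a bijection; and whenever $G\in S_i(M)$ is a face of $\bar G\in S_{i+1}(M)$, for each $F\in\phi^{-1}(G)$ there is $\bar F\in S_{i+1}(K)$ with $F\in\partial\bar F$ and $\phi(\bar F)=\bar G$. It is $k$-fold if every nonempty face $G$ of $M$ has exactly $k$ faces $F\in\phi^{-1}(G)$. Incidence and derived graphs. $B_i(K)$ is the bipartite graph with vertex set $S_i(K)\cup S_{i+1}(K)$ and edges $\{F,\bar F\}$ with $F\in S_i(K)$, $\bar F\in S_{i+1}(K)$, $F\in\partial\bar F$. With $[k]=\{1,\dots,k\}$ and $\mathbb{S}_k$ its symmetric group, a permutation assignment $\psi$ on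 a simple graph $B$ assigns to each ordered pair $(u,v)$ with $\{u,v\}\in E(B)$ an element $\psi(u,v)\in\mathbb{S}_k$, with $\psi(v,u)=\psi(u,v)^{-1}$. The derived graph $B^\psi$ has vertex set $V(B)\times[k]$, with $(u,a)$ adjacent to $(v,b)$ iff $\{u,v\}\in E(B)$ and $a=\psi(u,v)(b)$. Signs. Fix an orientation $[F]$ of every face (an ordering of vertices up to even permutations). If $[\bar F]=[v_0,\dots,v_{i+1}]$ and $F=\bar F\setminus\{v_j\}$, then $\operatorname{sgn}([F],\partial[\bar F])=(-1)^j$ if $[F]=[v_0,\dots,\hat v_j,\dots,v_{i+1}]$ and $-(-1)^j$ if $[F]$ is the opposite orientation; it is $0$ if $F\notin\partial\bar F$. For $[F]=[v_0,\dots,v_i]$, $F\in K$, $\operatorname{sgn}([F],[\phi(F)])=1$ if $[\phi(v_0),\dots,\phi(v_i)]$ is the chosen orientation of $\phi(F)$, and $-1$ otherwise. Laplacians. Weight functions $w_K,w_M$ assign positive reals to all faces. $W_i(K)$ is the diagonal matrix of weights of $i$-faces, $D_i(K)$ is the matrix of the coboundary map, with rows indexed by $S_{i+1}(K)$, columns by $S_i(K)$ and entries $\operatorname{sgn}([F],\partial[\bar F])$. The $i$-up Laplace operator, in matrix form, is $\mathcal{L}_i^{\mathrm{up}}(K)=W_i(K)^{-1}D_i(K)^\top W_{i+1}(K)D_i(K)$; similarly for $M$. Rows and columns of $\mathcal{L}_i^{\mathrm{up}}(K)$ are relabeled by $S_i(M)\times[k]$ via $\eta$: the index $(G,j)$ stands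 for the face $\eta(G,j)$. Further matrices. $\Lambda_i(M)^\eta$ is the diagonal matrix indexed by $S_i(M)\times[k]$ with $(G,j)$-entry $\operatorname{sgn}([\eta(G,j)],[G])$. $P^g=(p^g_{ab})$ with $p^g_{ab}=1$ if $a=g(b)$ and $0$ otherwise. For $g\in\Psi_i$, $D_i^g(M)$ is the $S_{i+1}(M)\times S_i(M)$ matrix with $(\bar G,G)$-entry $\operatorname{sgn}([G],\partial[\bar G])$ if $G\in\partial\bar G$ and $\psi(\bar G,G)=g$, and $0$ otherwise. $I$ is the identity matrix indexed by $S_i(M)$. The equality of block matrices uses the identification $A\otimes(B_1\oplus\cdots\oplus B_t)=(A\otimes B_1)\oplus\cdots\oplus(A\otimes B_t)$ (a simultaneous reordering of the basis). *)

(* Defs.v *)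
From HB Require Import structures.
From mathcomp Require Import all_boot all_order all_fingroup all_algebra.
From mathcomp Require Import mxrepresentation reals complex mxtens.

Set Implicit Arguments.
Unset Strict Implicit.
Unset Printing Implicit Defensive.

Import Order.TTheory GRing.Theory Num.Theory GroupScope.
Local Open Scope ring_scope.
Local Open Scope complex_scope.

(* Elements of the ground set V need not be vertices: the vertex set V(K) is
   [vertices K]. *)
Record scomplex (V : finType) := SComplex {
  faces :> {set {set V}};
  faces_closed : forall F G : {set V}, F \in faces -> G \subset F -> G \in faces;
  faces_set0 : set0 \in faces }.

Definition vertices (V : finType) (K : scomplex V) : {set V} :=
  [set v | [set v] \in K].

(* S_i(K) for i >= 0. *)
Definition face (V : finType) (K : scomplex V) (i : nat) :=
  {F : {set V} | (F \in K) && (#|F| == i.+1)}.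

Definition connected_complex (V : finType) (K : scomplex V) : Prop :=
  {in vertices K &, forall u v,
    connect (fun x y => (x != y) && ([set x; y] \in K)) u v}.

Section Coverings.
Variables (V U : finType) (K : scomplex V) (M : scomplex U) (phi : V -> U).

(* phi : V(K) -> V(M) is represented by a map of the ground sets; its values
   outside V(K) are irrelevant. *)
Definition simplicial : Prop := forall F, F \in K -> phi @: F \in M.

(* phi^{-1}(G) *)
Definition fiber (G : {set U}) : {set {set V}} :=
  [set F in K | phi @: F == G].

Record covering : Prop := Covering {
  covering_simplicial : simplicial;
  covering_connected : connected_complex K;
  covering_union : forall G, G \in M ->
    [set v in vertices K | phi v \in G] = \bigcup_(F in fiber G) F;
  covering_disjoint : forall G, G \in M -> trivIset (fiber G);
  (* surjectivity of F -> G is part of F \in fiber G *)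
  covering_inj : forall G F, G \in M -> F \in fiber G -> {in F &, injective phi};
  covering_lift : forall G Gbar F, G \in M -> Gbar \in M ->
    G \subset Gbar -> #|Gbar| = #|G|.+1 -> F \in fiber G ->
    exists Fbar : {set V}, [/\ Fbar \in K, #|Fbar| = #|F|.+1,
      F \subset Fbar & phi @: Fbar = Gbar] }.

Definition kfold_covering (k : nat) : Prop :=
  covering /\ (forall G, G \in M -> G != set0 -> #|fiber G| = k).

End Coverings.

(* The symmetric group with product (g * h)(x) = g (h x). The library's product
   on {perm T} is the opposite one, for which g |-> P^g is not multiplicative. *)
Definition cperm (T : finType) := {perm T}.

Section CPerm.
Variable T : finType.

HB.instance Definition _ := Finite.on (cperm T).

Definition cperm_mul (g h : cperm T) : cperm T := ((h : {perm T}) * (g : {perm T}))%g.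
Definition cperm_one : cperm T := (1 : {perm T})%g.
Definition cperm_inv (g : cperm T) : cperm T := (g : {perm T})^-1%g.

Lemma cperm_mulA : associative cperm_mul.
Proof. by move=> g h l; rewrite /cperm_mul mulgA. Qed.

Lemma cperm_mul1 : left_id cperm_one cperm_mul.
Proof. by move=> g; rewrite /cperm_mul mulg1. Qed.

Lemma cperm_mulV : left_inverse cperm_one cperm_inv cperm_mul.
Proof. by move=> g; rewrite /cperm_mul mulgV. Qed.

HB.instance Definition _ := Finite_isGroup.Build (cperm T)
  cperm_mulA cperm_mul1 cperm_mulV.

Lemma cpermM (g h : cperm T) x : (g * h)%g x = g (h x).
Proof. exact: permM. Qed.

Lemma cperm1 x : (1 : cperm T)%g x = x.
Proof. exact: perm1. Qed.

End CPerm.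

Section PermRepr.
Variables (F : fieldType) (k : nat) (G : {group cperm 'I_k}).

Definition pmx (g : cperm 'I_k) : 'M[F]_k := \matrix_(a, b) (a == g b)%:R.

Lemma pmx_repr : mx_repr G pmx.
Proof.
split=> [|g h _ _]; apply/matrixP=> a b; rewrite !mxE.
  by rewrite cperm1.
rewrite (bigD1 (h b)) //= !mxE eqxx mulr1 cpermM big1 ?addr0 // => c neq_c.
by rewrite !mxE (negPf neq_c) mulr0.
Qed.

Definition natural_repr : mx_representation F G k := MxRepresentation pmx_repr.

End PermRepr.

(* The vertex set S_i(K) \cup S_{i+1}(K) of B_i(K). *)
Definition Bvertex (V : finType) (K : scomplex V) (i : nat) : finType :=
  (face K i + face K i.+1)%type.

Definition Bset (V : finType) (K : scomplex V) (i : nat) (x : Bvertex K i) : {set V} :=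
  match x with inl F => val F | inr Fbar => val Fbar end.

Definition Bgraph (V : finType) (K : scomplex V) (i : nat) : rel (Bvertex K i) :=
  fun x y => match x, y with
  | inl F, inr Fbar | inr Fbar, inl F => val F \subset val Fbar
  | _, _ => false
  end.

Definition perm_assignment (T : finType) (e : rel T) (k : nat)
    (psi : T -> T -> cperm 'I_k) : Prop :=
  forall u v, e u v -> psi v u = (psi u v)^-1%g.

Definition derived_graph (T : finType) (e : rel T) (k : nat)
    (psi : T -> T -> cperm 'I_k) : rel (T * 'I_k) :=
  fun x y => e x.1 y.1 && (x.2 == psi x.1 y.1 y.2).

Definition graph_iso (T1 T2 : finType) (e1 : rel T1) (e2 : rel T2)
    (f : T1 -> T2) : Prop :=
  bijective f /\ (forall x y, e2 (f x) (f y) = e1 x y).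

Definition Psi_group (U : finType) (M : scomplex U) (i k : nat)
    (psi : Bvertex M i -> Bvertex M i -> cperm 'I_k) : {group cperm 'I_k} :=
  <<[set psi (inl p.1) (inr p.2) |
      p in [pred p : face M i * face M i.+1 | val p.1 \subset val p.2]]>>%G.

(* An orientation of F is represented by an ordering of F; two orderings give
   the same orientation iff they differ by an even permutation of the vertices. *)
Definition orientation (V : finType) (K : scomplex V)
    (o : {set V} -> seq V) : Prop :=
  forall F, F \in K -> uniq (o F) /\ o F =i F.

Definition same_orientation (V : finType) (s t : seq V) : bool :=
  [exists p : {perm V},
    [&& perm_on [set x in s] p, ~~ odd_perm p & map p s == t]].

Section Matrices.
Variable R : realType.
Local Notation C := R[i].

Section OneComplex.
Variables (V : finType) (K : scomplex V).
Variables (o : {set V} -> seq V) (w : {set V} -> R) (i : nat).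

(* sgn([F], d[Fbar]); the sum has one term if F is a facet of Fbar, none
   otherwise. *)
Definition sgn_bd (F Fbar : {set V}) : C :=
  \sum_(v in Fbar | F == Fbar :\ v)
    (-1) ^+ index v (o Fbar) *
    (if same_orientation (o F) (rem v (o Fbar)) then 1 else -1).

Definition W_mx : 'M[C]_#|{: face K i}| :=
  diag_mx (\row_a (w (val (enum_val a)))%:C).

Definition D_mx : 'M[C]_(#|{: face K i.+1}|, #|{: face K i}|) :=
  \matrix_(b, a) sgn_bd (val (enum_val a)) (val (enum_val b)).

End OneComplex.

Definition Lup (V : finType) (K : scomplex V) o w i : 'M[C]_#|{: face K i}| :=
  invmx (W_mx K w i) *m (D_mx K o i)^T *m W_mx K w i.+1 *m D_mx K o i.

Definition D_mx_at (U : finType) (M : scomplex U) (o : {set U} -> seq U)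
    (i k : nat) (psi : Bvertex M i -> Bvertex M i -> cperm 'I_k)
    (g : cperm 'I_k) : 'M[C]_(#|{: face M i.+1}|, #|{: face M i}|) :=
  \matrix_(b, a)
    let G : face M i := enum_val a in
    let Gbar : face M i.+1 := enum_val b in
    if (val G \subset val Gbar) && (psi (inr Gbar) (inl G) == g)
    then sgn_bd o (val G) (val Gbar) else 0.

(* sgn([F], [phi(F)]) *)
Definition sgn_cov (V U : finType) (phi : V -> U) (oK : {set V} -> seq V)
    (oM : {set U} -> seq U) (F : {set V}) : C :=
  if same_orientation (map phi (oK F)) (oM (phi @: F)) then 1 else -1.

Section Relabeling.
Variables (V U : finType) (K : scomplex V) (M : scomplex U) (i k : nat).
Variable eta : Bvertex M i * 'I_k -> Bvertex K i.

(* S_i(M) x [k] is enumerated as the index set of a Kronecker product; this is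
   eta at the pair (G, j) of index a. *)
Definition eta_at (a : 'I_(#|{: face M i}| * k)) : Bvertex K i :=
  let: (x, j) := mxtens_unindex a in eta (inl (enum_val x), j).

(* When phi (eta (G, j)) = G for a covering phi, eta maps S_i(M) x [k] to
   S_i(K), and the default 0 is never used. *)
Definition relabel (A : 'M[C]_#|{: face K i}|) :
    'M[C]_(#|{: face M i}| * k) :=
  \matrix_(a, b)
    match eta_at a, eta_at b with
    | inl F, inl F' => A (enum_rank F) (enum_rank F')
    | _, _ => 0
    end.

Definition Lambda_mx (phi : V -> U) (oK : {set V} -> seq V)
    (oM : {set U} -> seq U) : 'M[C]_(#|{: face M i}| * k) :=
  diag_mx (\row_a sgn_cov phi oK oM (Bset (eta_at a))).

End Relabeling.

(* A (+) B_0 (+) ... (+) B_(s-1) *)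
Definition dsum_mx (n s : nat) (d : 'I_s -> nat) (A : 'M[C]_n)
    (B : forall j, 'M[C]_(d j)) : 'M[C]_(n + \sum_j d j) :=
  block_mx A 0 0 (mxdiag B).

(* The reordering of the basis identifying A *t (1 (+) B_0 (+) ...) with
   A (+) (A *t B_0) (+) ..., where the two sides are indexed by pairs (x, y)
   with y in a block j, and by (x, y) in the block j, respectively. *)
Definition dsum_index (n k s : nat) (d : 'I_s -> nat)
    (dk : (1 + \sum_j d j)%N = k) (a : 'I_(n * k)) :
    'I_(n + \sum_j (n * d j)%N) :=
  let: (x, y) := mxtens_unindex a in
  match split (cast_ord (esym dk) y) with
  | inl _ => lshift _ x
  | inr z => rshift n (@tagnat.Rank s (fun j => (n * d j)%N) (tagnat.sig1 z)
                         (mxtens_index (x, tagnat.sig2 z)))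
  end.

End Matrices.

(* Main.v *)
Require Import Defs.
From HB Require Import structures.
From mathcomp Require Import all_boot all_order all_fingroup all_algebra.
From mathcomp Require Import mxrepresentation reals complex mxtens.
From mathcomp Require Import ring.

(** Write P^g for the permutation matrix of g and D^g for the part of the
    coboundary matrix D of M carried by the incidences of voltage g.

    The graph isomorphism [eta] says that the lift of an (i+1)-face z on sheet c
    contains the lift of an i-face x on sheet j exactly when x is a facet of z
    and c is the image of j under psi(z, x). Hence the coboundary matrix of K,
    indexed by faces of M and sheets, has the same nonzero pattern as the sum of
    the D^g tensor P^g. The entries also agree after multiplication by the signs
    comparing the orientation of each face of K with that of its image
    ([sgn_lift]). This is a statement on signs of reorderings. They are treated
    as determinants of permutation matrices, for which the deletion of a vertex
    from two orderings is a Laplace expansion ([osign_rem], [sgn_bd_cov]).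

    Weights are pulled back from M, so conjugating the relabeled Laplacian of K
    by Lambda gives the product of the sums of W_i^-1 (D^g)^T tensor P^(g^-1)
    and of W_(i+1) D^g tensor P^g ([relabel_Lup]). The conjugation by I tensor T
    then splits each factor into blocks, one for each constituent of the
    permutation representation ([conj_tens_sum]). A product of block diagonal
    matrices is taken blockwise, and in the block of the trivial representation
    the D^g add up to D, so that this block is the Laplacian of M. *)

Set Implicit Arguments.
Unset Strict Implicit.
Unset Printing Implicit Defensive.

Import Order.TTheory GRing.Theory Num.Theory.
Local Open Scope ring_scope.
Local Open Scope complex_scope.

(** * Orientation signs as determinants *)

(** An odd permutation of positions must be compared with an odd permutation
    of vertices. Parities of permutations of different types are related
    through a factorization into transpositions, each of which is carried along
    the injection. *)
Lemma perm_extend (W V : finType) (f : W -> V) (q : {perm W}) :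
  injective f ->
  exists p : {perm V},
    [/\ perm_on [set x in codom f] p, odd_perm p = odd_perm q
      & forall a, p (f a) = f (q a)].
Proof.
move=> inj_f; have [ts -> _] := prod_tpermP q.
elim: ts => [|[x y] ts [p [p_on odd_p pf]]].
  by exists 1%g; rewrite big_nil perm_on1 !odd_perm1; split=> // a; rewrite !perm1.
exists (tperm (f x) (f y) * p)%g; rewrite big_cons /=; split=> [||a].
- apply: perm_onM => //; apply: subset_trans (tperm_on _ _) _.
  by apply/subsetP=> z /[!inE] /orP[] /eqP->; rewrite codom_f.
- by rewrite !odd_permM !odd_tperm odd_p (inj_eq inj_f).
- by rewrite !permM -inj_tperm.
Qed.

Section Sign.
Variable R : comPzRingType.

(** The permutation matrix carrying [t] to [s] when both enumerate the same
    [n]-element set. *)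
Definition match_mx (V : eqType) n (s t : seq V) : 'M[R]_n :=
  \matrix_(a, b) (onth s a == onth t b)%:R.

Lemma onth_lt (V : eqType) (s : seq V) a :
  (a < size s)%N -> exists2 x, onth s a = Some x & x \in s.
Proof.
by rewrite -onthTE; case E: (onth s a) => [x|//] _; exists x => //; apply/onthP; exists a.
Qed.

Lemma onth_index (V : eqType) (s : seq V) x : x \in s -> onth s (index x s) = Some x.
Proof. by move=> sx; rewrite onthE (nth_map x) ?index_mem // nth_index. Qed.

Lemma onth_uniq (V : eqType) (s : seq V) x a :
  uniq s -> onth s a = Some x -> a = index x s.
Proof.
move=> uniq_s sa; have lt_a : (a < size s)%N by rewrite -onthTE sa.
have := odflt_onth x s a; rewrite sa /= => ->.
by rewrite index_uniq.
Qed.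

Lemma match_mxM (V : eqType) n (s t u : seq V) :
  size s = n -> size t = n -> uniq t -> {subset s <= t} ->
  match_mx n s t *m match_mx n t u = match_mx n s u.
Proof.
move=> size_s size_t uniq_t sub_st; apply/matrixP=> a c; rewrite !mxE.
have [|x sa xs] := @onth_lt _ s a; first by rewrite size_s.
have tx := sub_st _ xs.
have b0P : (index x t < n)%N by rewrite -size_t index_mem.
rewrite (bigD1 (Ordinal b0P)) //= !mxE sa onth_index // eqxx mul1r big1 ?addr0 //.
move=> b neq_b; rewrite !mxE sa; case: eqP => [tb|]; last by rewrite mul0r.
case/eqP: neq_b; apply: val_inj => /=.
exact: onth_uniq uniq_t (esym tb).
Qed.

(** The sign of the reordering from [s] to [t]. As a determinant, it inherits
    its multiplicativity from matrix products, its invariance under injective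
    relabeling from the equality of the matrices, and its behaviour under
    deletion of a vertex from the Laplace expansion. *)
Definition osign (V : eqType) n (s t : seq V) : R := \det (match_mx n s t).

Lemma osignM (V : eqType) n (s t u : seq V) :
  size s = n -> size t = n -> uniq t -> {subset s <= t} ->
  osign n s t * osign n t u = osign n s u.
Proof. by move=> *; rewrite /osign -det_mulmx match_mxM. Qed.

Lemma osignC (V : eqType) n (s t : seq V) : osign n s t = osign n t s.
Proof.
rewrite /osign -det_tr; congr (\det _); apply/matrixP=> a b.
by rewrite !mxE eq_sym.
Qed.

Lemma osign_map (V U : eqType) (f : V -> U) n (s t : seq V) :
  size s = n -> size t = n -> {in s & t, injective f} ->
  osign n (map f s) (map f t) = osign n s t.
Proof.
move=> size_s size_t inj_f; congr (\det _); apply/matrixP=> a b; rewrite !mxE.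
have [|x sa xs] := @onth_lt _ s a; first by rewrite size_s.
have [|y tb yt] := @onth_lt _ t b; first by rewrite size_t.
rewrite !onth_map sa tb /=; congr (nat_of_bool _)%:R.
by apply/eqP/eqP=> [[/(inj_f _ _ xs yt)->]|[->]].
Qed.

Lemma onth_rem (V : eqType) (s : seq V) x a :
  x \in s -> onth (rem x s) a = onth s (bump (index x s) a).
Proof.
elim: s a => //= y s IHs a; rewrite inE eq_sym.
case: eqVneq => [_ _ //|_ /= xs]; case: a => [|a] //=.
by rewrite bumpS /= IHs.
Qed.

(** The row of [x] has its only nonzero entry in the column of [x], so the
    Laplace expansion along it has one term, whose minor compares the two
    orderings with [x] deleted. *)
Lemma osign_rem (V : eqType) n (s t : seq V) x :
  size s = n.+1 -> size t = n.+1 -> uniq t -> x \in s -> x \in t ->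
  osign n.+1 s t =
    (-1) ^+ index x s * (-1) ^+ index x t * osign n (rem x s) (rem x t).
Proof.
move=> size_s size_t uniq_t xs xt.
have aP : (index x s < n.+1)%N by rewrite -size_s index_mem.
have bP : (index x t < n.+1)%N by rewrite -size_t index_mem.
rewrite /osign (expand_det_row _ (Ordinal aP)) (bigD1 (Ordinal bP)) //=.
rewrite mxE /= !onth_index // eqxx mul1r big1 ?addr0.
  rewrite /cofactor /= exprD; congr (_ * \det _).
  by apply/matrixP=> a b; rewrite !mxE /= !onth_rem.
move=> b neq_b; rewrite mxE /= onth_index //; case: eqP => [tb|]; last by rewrite mul0r.
case/eqP: neq_b; apply: val_inj => /=.
exact: onth_uniq uniq_t (esym tb).
Qed.

Lemma onth_tnth (V : Type) n (u : n.-tuple V) (c : 'I_n) : onth u c = Some (tnth u c).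
Proof.
have lt_c : (c < size u)%N by rewrite size_tuple.
by rewrite onthE (nth_map (tnth u c)) // -tnth_nth.
Qed.

(** The permutation of the vertices that turns [s] into [t] is unique because
    it fixes everything outside [s]; so an even one exists exactly when the
    permutation of positions is even. *)
Lemma same_orientationE (V : finType) n (s t : seq V) :
  size s = n -> uniq s -> uniq t -> s =i t ->
  (if same_orientation s t then 1 else -1) = osign n s t :> R.
Proof.
move=> <- uniq_s uniq_t eq_st.
have perm_ts : perm_eq t (in_tuple s).
  by apply: uniq_perm => // x; rewrite eq_st.
have [q tE] := tuple_permP perm_ts.
have inj_s : injective (tnth (in_tuple s)).
  exact/tuple_uniqP.
have mem_s : codom (tnth (in_tuple s)) =i s.
  by move=> x; rewrite codomE map_tnth_enum.
have -> : osign (size s) s t = (-1) ^+ q.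
  rewrite -det_perm -[in RHS]det_tr /osign; congr (\det _).
  apply/matrixP=> a b; rewrite !mxE tE -[s in onth s]/(tval (in_tuple s)).
  rewrite !onth_tnth tnth_mktuple; congr (nat_of_bool _)%:R.
  by rewrite -(inj_eq inj_s) eq_sym.
have [p [p_on odd_p pq]] := perm_extend q inj_s.
have pE : map p s = t.
  rewrite tE -[s in LHS](map_tnth_enum (in_tuple s)) -map_comp.
  by apply: eq_map => a /=; rewrite pq.
have -> : same_orientation s t = ~~ odd_perm q.
  apply/existsP/idP=> [[p' /and3P[p'_on odd_p' /eqP p'E]]|even_q].
    suff p'p : p' = p by rewrite -odd_p -p'p.
    apply/permP=> x; have [xs|xNs] := boolP (x \in s).
      by move: x xs; apply/eq_in_map; rewrite p'E.
    by rewrite (out_perm p'_on) ?(out_perm p_on) // inE ?mem_s.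
  exists p; apply/and3P; split; rewrite ?pE ?odd_p //.
  by apply: subset_trans p_on _; apply/subsetP=> x; rewrite !inE mem_s.
by case: (odd_perm q).
Qed.
End Sign.

(** * Boundary signs under a covering *)

Lemma index_map_in (V U : eqType) (f : V -> U) (s : seq V) x :
  x \in s -> {in s &, injective f} -> index (f x) (map f s) = index x s.
Proof.
elim: s => //= y s IHs; rewrite inE eq_sym => xys inj_f.
have [->|neq_yx] := eqVneq y x; first by rewrite eqxx.
have xs : x \in s by case/orP: xys => // /eqP yx; rewrite yx eqxx in neq_yx.
rewrite (inj_in_eq inj_f) ?inE ?eqxx ?xs ?orbT // (negPf neq_yx) IHs //.
by apply: sub_in2 inj_f => z zs; rewrite inE zs orbT.
Qed.

Lemma map_rem_in (V U : eqType) (f : V -> U) (s : seq V) x :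
  x \in s -> {in s &, injective f} -> rem (f x) (map f s) = map f (rem x s).
Proof. by move=> xs inj_f; rewrite !remE index_map_in // map_cat map_take map_drop. Qed.

Lemma size_enumeration (V : finType) (s : seq V) (F : {set V}) :
  uniq s -> s =i F -> size s = #|F|.
Proof. by move=> /card_uniqP <- eq_sF; apply: eq_card. Qed.

Section Boundary.
Variable R : realType.
Local Notation C := R[i].

Section OneComplex.
Variables (V : finType) (o : {set V} -> seq V).

Lemma sgn_bd_notin (F Fbar : {set V}) :
  ~~ (F \subset Fbar) -> sgn_bd R o F Fbar = 0.
Proof.
move=> nsub; rewrite /sgn_bd big1 // => v /andP[_ /eqP FE].
by rewrite FE subD1set in nsub.
Qed.

Lemma sgn_bdE (Fbar : {set V}) v n :
  uniq (o Fbar) -> o Fbar =i Fbar ->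
  uniq (o (Fbar :\ v)) -> o (Fbar :\ v) =i Fbar :\ v ->
  v \in Fbar -> #|Fbar| = n.+1 ->
  sgn_bd R o (Fbar :\ v) Fbar =
    (-1) ^+ index v (o Fbar) * osign C n (o (Fbar :\ v)) (rem v (o Fbar)).
Proof.
move=> uo mo uo' mo' vF card_F; rewrite /sgn_bd (bigD1 v) ?vF ?eqxx //=.
rewrite big1 ?addr0; last first.
  move=> u /andP[/andP[uF /eqP/setP/(_ u)]]; rewrite !inE eqxx uF andbT /=.
  by move=> ->.
congr (_ * _); apply: same_orientationE; rewrite ?rem_uniq //.
  apply: succn_inj; rewrite -card_F (size_enumeration uo' mo').
  by rewrite (cardsD1 v Fbar) vF.
by move=> x; rewrite mo' mem_rem_uniq // !inE mo.
Qed.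
End OneComplex.

(** With [s], [t] the orderings of [F], [phi @: F] and [s'], [t'] those of
    [Fbar], [phi @: Fbar], the reordering from [t] to [t'] with [phi v] deleted
    is factored through [phi s] and through [phi s'] with [phi v] deleted. The
    first factor is the covering sign of [F]. Up to the signs of the positions
    of [v] and [phi v], the second is the boundary sign in the covering complex
    and the third is, by Laplace expansion, the covering sign of [Fbar]. *)
Lemma sgn_bd_cov (V U : finType) (phi : V -> U)
    (oK : {set V} -> seq V) (oM : {set U} -> seq U) (F Fbar : {set V}) :
  uniq (oK Fbar) -> oK Fbar =i Fbar -> uniq (oK F) -> oK F =i F ->
  uniq (oM (phi @: Fbar)) -> oM (phi @: Fbar) =i phi @: Fbar ->
  uniq (oM (phi @: F)) -> oM (phi @: F) =i phi @: F ->
  {in Fbar &, injective phi} -> F \subset Fbar -> #|Fbar| = #|F|.+1 ->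
  sgn_bd R oM (phi @: F) (phi @: Fbar) =
    sgn_cov R phi oK oM Fbar * sgn_bd R oK F Fbar * sgn_cov R phi oK oM F.
Proof.
move=> us' ms' us ms ut' mt' ut mt inj_phi sub_F card_F.
have [v vD] : exists v, Fbar :\: F = [set v].
  apply/cards1P; rewrite cardsD (setIidPr sub_F) card_F.
  by rewrite subSnn.
have vF : v \in Fbar by have := set11 v; rewrite -vD inE => /andP[].
have FE : F = Fbar :\ v.
  by rewrite -vD setDDr setDv set0U (setIidPr sub_F).
have phiFE : phi @: F = (phi @: Fbar) :\ phi v.
  apply/setP=> y; rewrite in_setD1; apply/imsetP/andP.
    move=> [x]; rewrite FE in_setD1 => /andP[neq_xv xF] ->.
    by rewrite imset_f // (inj_in_eq inj_phi).
  move=> [neq_y /imsetP[x xF yE]]; exists x => //; rewrite FE in_setD1 xF andbT.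
  by apply: contra neq_y => /eqP <-; rewrite yE.
have inj_s' : {in oK Fbar &, injective phi}.
  by move=> x y; rewrite !ms'; apply: inj_phi.
have sub_s : {subset oK F <= oK Fbar}.
  by move=> x; rewrite ms ms'; apply: (subsetP sub_F).
have inj_s : {in oK F &, injective phi} by apply: sub_in2 inj_s'.
have sub_rem : {subset rem v (oK Fbar) <= oK Fbar} by move=> x /mem_rem.
have size_s : size (oK F) = #|F| by apply: size_enumeration.
have size_s' : size (oK Fbar) = #|F|.+1 by rewrite -card_F; apply: size_enumeration.
have card_phiF : #|phi @: F| = #|F|.
  by rewrite card_in_imset // => x y xF yF; apply: inj_phi; apply: (subsetP sub_F).
have card_phiF' : #|phi @: Fbar| = #|F|.+1 by rewrite card_in_imset.
have size_t : size (oM (phi @: F)) = #|F| by rewrite -card_phiF; apply: size_enumeration.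
have size_t' : size (oM (phi @: Fbar)) = #|F|.+1.
  by rewrite -card_phiF'; apply: size_enumeration.
have map_mem (G : {set V}) (s : seq V) : s =i G -> map phi s =i phi @: G.
  move=> msG y; apply/mapP/imsetP=> [] [x xs ->]; exists x => //.
    by rewrite -msG.
  by rewrite msG.
have covE (G : {set V}) n : G \subset Fbar -> #|G| = n -> uniq (oK G) -> oK G =i G ->
    uniq (oM (phi @: G)) -> oM (phi @: G) =i phi @: G ->
    sgn_cov R phi oK oM G = osign C n (map phi (oK G)) (oM (phi @: G)).
  move=> sGF cG uG mG uG' mG'; apply: same_orientationE => //.
  - by rewrite size_map (size_enumeration uG mG).
  - rewrite map_inj_in_uniq // => x y; rewrite !mG => xG yG.
    by apply: inj_phi; apply: (subsetP sGF).
  - by move=> y; rewrite mG' (map_mem _ _ mG).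
rewrite (covE _ _ sub_F (erefl _)) // (covE _ _ (subxx _) card_F) //.
have vs' : v \in oK Fbar by rewrite ms'.
have pvt' : phi v \in oM (phi @: Fbar) by rewrite mt' imset_f.
have ums : uniq (map phi (oK F)) by rewrite map_inj_in_uniq.
have ms'F : rem v (oK Fbar) =i F.
  by move=> x; rewrite FE mem_rem_uniq // !inE ms'.
have ur : uniq (rem v (oK Fbar)) by apply: rem_uniq.
rewrite (@osign_rem _ _ _ _ _ (phi v)) ?size_map ?map_f //.
rewrite index_map_in // map_rem_in //.
have -> : sgn_bd R oK F Fbar =
    (-1) ^+ index v (oK Fbar) * osign C #|F| (oK F) (rem v (oK Fbar)).
  by rewrite [in LHS]FE (@sgn_bdE _ _ _ _ #|F|) -?FE.
have -> : sgn_bd R oM (phi @: F) (phi @: Fbar) =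
    (-1) ^+ index (phi v) (oM (phi @: Fbar)) *
      osign C #|F| (oM (phi @: F)) (rem (phi v) (oM (phi @: Fbar))).
  by rewrite [in LHS]phiFE (@sgn_bdE _ _ _ _ #|F|) -?phiFE ?imset_f.
have size_r : size (rem v (oK Fbar)) = #|F| by rewrite size_rem // size_s'.
rewrite -(@osignM _ _ _ _ (map phi (oK F))) ?size_map //; last first.
  by move=> y; rewrite mt (map_mem _ _ ms).
rewrite -(@osignM _ _ _ (map phi (oK F)) (map phi (rem v (oK Fbar)))) ?size_map //.
- rewrite osign_map //; last first.
    by move=> x y xs /sub_rem ys; apply: inj_s' => //; apply: sub_s.
  rewrite (osignC _ _ (oM _) (map _ _)).
  (* The position sign of [v] enters twice, so it cancels. *)
  set a := (-1) ^+ index v _; have aa : a * a = 1 by rewrite -expr2 sqrr_sign.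
  by rewrite -[LHS]mul1r -aa; ring.
- by rewrite map_inj_in_uniq //; apply: sub_in2 inj_s'.
- by move=> y; rewrite (map_mem _ _ ms) (map_mem _ _ ms'F).
Qed.
End Boundary.

(** * Block diagonal matrices and the reordering of the Kronecker basis *)

Section BlockDiag.
Variable R : pzRingType.
Import tagnat.

Lemma mxblockRank s t (p : 'I_s -> nat) (q : 'I_t -> nat)
    (B : forall j l, 'M[R]_(p j, q l)) j l x y :
  (\mxblock_(j, l) B j l) (Rank j x) (Rank l y) = B j l x y.
Proof. by rewrite -[B j l in RHS](mxblockK B j l) [RHS]mxE. Qed.

(** The factors of the Laplacian go between the i-faces and the (i+1)-faces, so
    the blocks are rectangular. For square blocks this is convertible to
    [mxdiag]. *)
Definition rdiag (s : nat) (p q : 'I_s -> nat) (B : forall j, 'M[R]_(p j, q j)) :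
    'M[R]_(\sum_j p j, \sum_j q j) :=
  \mxblock_(j, l) if j == l then conform_mx 0 (B j) else 0.

Lemma rdiagE s (p q : 'I_s -> nat) (B : forall j, 'M[R]_(p j, q j)) j x y :
  rdiag B (Rank j x) (Rank j y) = B j x y.
Proof. by rewrite mxblockRank eqxx conform_mx_id. Qed.

Lemma rdiag0 s (p q : 'I_s -> nat) (B : forall j, 'M[R]_(p j, q j)) j l x y :
  j != l -> rdiag B (Rank j x) (Rank l y) = 0.
Proof. by move=> /negPf neq_jl; rewrite mxblockRank neq_jl mxE. Qed.

Definition rdsum (m n s : nat) (p q : 'I_s -> nat)
    (A : 'M[R]_(m, n)) (B : forall j, 'M[R]_(p j, q j)) :
    'M[R]_(m + \sum_j p j, n + \sum_j q j) :=
  block_mx A 0 0 (rdiag B).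

Lemma mul_rdsum m n l s (p q r : 'I_s -> nat)
    (A : 'M[R]_(m, n)) (B : forall j, 'M[R]_(p j, q j))
    (A' : 'M[R]_(n, l)) (B' : forall j, 'M[R]_(q j, r j)) :
  rdsum A B *m rdsum A' B' = rdsum (A *m A') (fun j => B j *m B' j).
Proof.
rewrite /rdsum mulmx_block !mulmx0 !mul0mx !addr0 !add0r; congr block_mx.
rewrite mul_mxblock; apply: eq_mxblock => j j'.
rewrite (bigD1 j) //= eqxx conform_mx_id big1 ?addr0.
  by case: eqP => [<-|_]; rewrite ?conform_mx_id // mulmx0.
by move=> i /negPf; rewrite eq_sym => ->; rewrite mul0mx.
Qed.

Lemma rdsum_sum (I : finType) (P : pred I) m n s (p q : 'I_s -> nat)
    (A : I -> 'M[R]_(m, n)) (B : I -> forall j, 'M[R]_(p j, q j)) :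
  \sum_(g | P g) rdsum (A g) (B g) =
  rdsum (\sum_(g | P g) A g) (fun j => \sum_(g | P g) B g j).
Proof.
apply/matrixP=> a b; rewrite summxE.
case: (split_ordP a) => {}a ->; case: (split_ordP b) => {}b ->.
- by rewrite block_mxEul summxE; apply: eq_bigr => g _; rewrite block_mxEul.
- by rewrite block_mxEur mxE big1 // => g _; rewrite block_mxEur mxE.
- by rewrite block_mxEdl mxE big1 // => g _; rewrite block_mxEdl mxE.
rewrite block_mxEdr (eq_bigr (fun g => rdiag (B g) a b)) => [|g _]; last first.
  by rewrite block_mxEdr.
rewrite -(sig2K a) -(sig2K b); move: (sig1 a) (sig2 a) (sig1 b) (sig2 b).
move=> {a b} j x l y; have [jl|neq_jl] := eqVneq j l.
  by case: l / jl y => y; rewrite rdiagE summxE; apply: eq_bigr => g _; rewrite rdiagE.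
by rewrite rdiag0 // big1 // => g _; rewrite rdiag0.
Qed.
End BlockDiag.

Section Reindexing.
Variables (s : nat) (d : 'I_s -> nat).

Lemma dsum_index_lshift n (x : 'I_n) (y : 'I_1) :
  dsum_index (d := d) erefl (mxtens_index (x, lshift _ y)) = lshift _ x.
Proof.
by rewrite /dsum_index mxtens_indexK cast_ord_id -[lshift _ y]/(unsplit (inl y))
  unsplitK.
Qed.

Lemma dsum_index_rshift n (x : 'I_n) z :
  dsum_index (d := d) erefl (mxtens_index (x, rshift 1 z)) =
    rshift n (tagnat.Rank (tagnat.sig1 z) (mxtens_index (x, tagnat.sig2 z))).
Proof.
by rewrite /dsum_index mxtens_indexK cast_ord_id -[rshift _ z]/(unsplit (inr z))
  unsplitK.
Qed.

(** The identification of A tensor (1 + B_1 + ... + B_t) with the sum of the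
    A tensor B_j, for rectangular A: the same reordering of the second
    tensor factor is used on rows and columns. *)
Lemma tens_dsum (R : realType) m n k (dk : (1 + \sum_j d j)%N = k)
    (A : 'M[R[i]]_(m, n)) (B : forall j, 'M[R[i]]_(d j)) :
  A *t castmx (dk, dk) (dsum_mx (1%:M : 'M_1) B) =
  mxsub (dsum_index (n := m) dk) (dsum_index (n := n) dk)
    (rdsum A (fun j => A *t B j)).
Proof.
case: k / dk; rewrite castmx_id; apply/matrixP=> a b; rewrite [RHS]mxE.
case: (mxtens_indexP a) => x y; case: (mxtens_indexP b) => x' y'.
rewrite tensmxE.
case: (split_ordP y) => {}y ->; case: (split_ordP y') => {}y' ->.
- by rewrite !dsum_index_lshift !block_mxEul mxE !ord1 eqxx mulr1.
- by rewrite dsum_index_lshift dsum_index_rshift !block_mxEur !mxE mulr0.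
- by rewrite dsum_index_lshift dsum_index_rshift !block_mxEdl !mxE mulr0.
rewrite !dsum_index_rshift !block_mxEdr -[mxdiag B]/(rdiag B).
rewrite -[y in rdiag B y](tagnat.sig2K y) -[y' in rdiag B _ y'](tagnat.sig2K y').
move: (tagnat.sig1 y) (tagnat.sig2 y) (tagnat.sig1 y') (tagnat.sig2 y').
move=> {y y'} j y l y'; have [jl|neq_jl] := eqVneq j l.
  by case: l / jl y' => y'; rewrite !rdiagE tensmxE.
by rewrite !rdiag0 // mulr0.
Qed.

(** Being a bijection is what makes the reordering compatible with matrix
    products. *)
Lemma dsum_index_bij n k (dk : (1 + \sum_j d j)%N = k) :
  bijective (dsum_index (n := n) dk).
Proof.
apply: inj_card_bij; last first.
  by rewrite !card_ord -dk mulnDr muln1 big_distrr.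
case: k / dk => a b.
case: (mxtens_indexP a) => x y; case: (mxtens_indexP b) => x' y'.
case: (split_ordP y) => {}y ->; case: (split_ordP y') => {}y' ->.
- by rewrite !dsum_index_lshift => /lshift_inj ->; rewrite !ord1.
- by rewrite dsum_index_lshift dsum_index_rshift => /eqP; rewrite eq_lrshift.
- by rewrite dsum_index_lshift dsum_index_rshift => /eqP; rewrite eq_rlshift.
rewrite !dsum_index_rshift => /rshift_inj eq_r.
suff [-> ->] : x = x' /\ y = y' by [].
rewrite -(tagnat.sig2K y) -(tagnat.sig2K y').
move: (tagnat.sig1 y) (tagnat.sig2 y) (tagnat.sig1 y') (tagnat.sig2 y') eq_r.
move=> {y y'} j y l y' eq_r.
have := tagnat.eq_Rank (p_ := fun j => (n * d j)%N)
  (mxtens_index (x, y)) (mxtens_index (x', y')).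
rewrite eq_r eqxx => /esym/andP[/eqP jl].
case: l / jl y' {eq_r} => y' /eqP /val_inj/(can_inj (@mxtens_indexK _ _)) [-> ->].
by [].
Qed.
End Reindexing.

Lemma mulmx_mxsub_bij (R : pzRingType) m n n' p q l (f : 'I_m -> 'I_p)
    (r : 'I_n' -> 'I_n) (h : 'I_q -> 'I_l) (A : 'M[R]_(p, n)) (B : 'M_(n, l)) :
  bijective r -> mxsub f r A *m mxsub r h B = mxsub f h (A *m B).
Proof.
move=> bij_r; apply/matrixP=> a b; rewrite !mxE (reindex r) /=; last exact: onW_bij.
by apply: eq_bigr => c _; rewrite !mxE.
Qed.

Lemma invmx_diag (F : fieldType) n (v : 'rV[F]_n) :
  (forall a, v 0 a != 0) -> invmx (diag_mx v) = diag_mx (\row_a (v 0 a)^-1).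
Proof.
move=> v_neq0; have vV : diag_mx v *m diag_mx (\row_a (v 0 a)^-1) = 1%:M.
  apply/matrixP=> a b; rewrite mul_diag_mx !mxE; case: eqP => [->|_].
    by rewrite mulfV.
  by rewrite mulr0.
by rewrite -[RHS]mul1mx -(mulVmx (mulmx1_unit vV).1) -mulmxA vV mulmx1.
Qed.

Lemma tensmx11 (R : pzRingType) m k :
  (1%:M : 'M[R]_m) *t (1%:M : 'M_k) = 1%:M.
Proof.
apply/matrixP=> a b; case: (mxtens_indexP a) => x y; case: (mxtens_indexP b) => x' y'.
rewrite tensmxE !mxE (can_eq (@mxtens_indexK _ _)) xpair_eqE.
by case: (x == x'); case: (y == y'); rewrite ?mulr1 ?mulr0.
Qed.

Lemma invmx_tens1 (F : fieldType) m k (T : 'M[F]_k) :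
  T \in unitmx -> invmx ((1%:M : 'M_m) *t T) = 1%:M *t invmx T.
Proof.
move=> T_unit.
have TV : ((1%:M : 'M_m) *t T) *m (1%:M *t invmx T) = 1%:M.
  by rewrite tensmx_mul mulmx1 mulmxV // tensmx11.
by rewrite -[RHS]mul1mx -(mulVmx (mulmx1_unit TV).1) -mulmxA TV mulmx1.
Qed.

(** Conjugation by T acts on the second tensor factor only, where the
    decomposition of the permutation representation applies term by term. The
    map [h] is the identity for the coboundary and the inversion for its
    transpose. *)
Lemma conj_tens_sum (R : realType) (k : nat) (G : {group cperm 'I_k})
    (s : nat) (d : 'I_s -> nat) (rho : forall j, mx_representation R[i] G (d j))
    (dk : (1 + \sum_j d j)%N = k) (T : 'M[R[i]]_k) m n
    (A : cperm 'I_k -> 'M[R[i]]_(m, n)) (h : cperm 'I_k -> cperm 'I_k) :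
  (forall g, g \in G -> invmx T *m pmx R[i] g *m T =
      castmx (dk, dk) (dsum_mx (1%:M : 'M_1) (fun j => rho j g))) ->
  (forall g, g \in G -> h g \in G) ->
  (1%:M *t invmx T) *m (\sum_(g in G) A g *t pmx R[i] (h g)) *m (1%:M *t T) =
  mxsub (dsum_index dk) (dsum_index dk)
    (rdsum (\sum_(g in G) A g) (fun j => \sum_(g in G) A g *t rho j (h g))).
Proof.
move=> T_decomp hG; rewrite -rdsum_sum mulmx_sumr mulmx_suml linear_sum.
apply: eq_bigr => g Gg /=.
by rewrite !tensmx_mul mul1mx mulmx1 T_decomp ?hG // tens_dsum.
Qed.

(** * The up Laplacian and the voltage components of the coboundary *)

Lemma D_mx_atE (R : realType) (U : finType) (M : scomplex U) o i k
    (psi : Bvertex M i -> Bvertex M i -> cperm 'I_k) g b a :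
  D_mx_at R o psi g b a =
  if (val (enum_val a) \subset val (enum_val b))
     && (psi (inr (enum_val b)) (inl (enum_val a)) == g)
  then sgn_bd R o (val (enum_val a)) (val (enum_val b)) else 0.
Proof. by rewrite mxE. Qed.

(** Each incidence of M is recorded by exactly one D^g; this identifies the
    summand of the trivial representation with the Laplacian of M. *)
Lemma D_mx_at_sum (R : realType) (U : finType) (M : scomplex U) o i k
    (psi : Bvertex M i -> Bvertex M i -> cperm 'I_k) (G : {group cperm 'I_k}) :
  (forall (x : face M i) (z : face M i.+1),
     val x \subset val z -> psi (inr z) (inl x) \in G) ->
  \sum_(g in G) D_mx_at R o psi g = D_mx R M o i.
Proof.
move=> psiG; apply/matrixP=> b a; rewrite summxE mxE.
have [sub|nsub] := boolP (val (enum_val a) \subset val (enum_val b)).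
  rewrite (big_only1 (psi (inr (enum_val b)) (inl (enum_val a)))) ?psiG //.
    by rewrite D_mx_atE sub eqxx.
  by move=> g /negPf neq_g _; rewrite D_mx_atE eq_sym neq_g andbF.
rewrite sgn_bd_notin // big1 // => g _.
by rewrite D_mx_atE (negPf nsub).
Qed.

Lemma invW_mx (R : realType) (V : finType) (K : scomplex V) (w : {set V} -> R) i :
  (forall F, F \in K -> 0 < w F) ->
  invmx (W_mx K w i) = diag_mx (\row_a (w (val (enum_val a)))%:C^-1).
Proof.
move=> w_gt0; rewrite invmx_diag => [|a].
  by congr diag_mx; apply/rowP=> a; rewrite !mxE.
rewrite mxE (inj_eq (@complexI R)); apply: lt0r_neq0; apply: w_gt0.
by case/andP: (valP (enum_val a)).
Qed.

Lemma LupE (R : realType) (V : finType) (K : scomplex V) o (w : {set V} -> R) i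
    (F F' : face K i) :
  (forall F, F \in K -> 0 < w F) ->
  Lup K o w i (enum_rank F) (enum_rank F') =
  \sum_(Z : face K i.+1) (w (val F))%:C^-1 * sgn_bd R o (val F) (val Z) *
     (w (val Z))%:C * sgn_bd R o (val F') (val Z).
Proof.
move=> w_gt0; rewrite /Lup invW_mx // mul_diag_mx mul_mx_diag mxE.
rewrite (reindex (@enum_val (face K i.+1) predT)) /=; last first.
  exact/onW_bij/enum_val_bij.
by apply: eq_bigr => c _; rewrite !mxE !enum_rankK.
Qed.

Lemma card_face (V : finType) (K : scomplex V) i (F : face K i) : #|val F| = i.+1.
Proof. by case/andP: (valP F) => _ /eqP. Qed.

Lemma Bset_inl (V : finType) (K : scomplex V) i (F : face K i) :
  Bset (inl F : Bvertex K i) = val F.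
Proof. by []. Qed.

Lemma Bset_inr (V : finType) (K : scomplex V) i (F : face K i.+1) :
  Bset (inr F : Bvertex K i) = val F.
Proof. by []. Qed.

(** * Lifting the coboundary through the covering *)

Section Cover.
Variables (R : realType) (V U : finType) (K : scomplex V) (M : scomplex U).
Variables (phi : V -> U) (k i : nat).
Hypothesis phi_cov : covering K M phi.
Variables (psi : Bvertex M i -> Bvertex M i -> cperm 'I_k).
Hypothesis psi_assign : perm_assignment (@Bgraph U M i) psi.
Variable eta : Bvertex M i * 'I_k -> Bvertex K i.
Hypothesis eta_iso : graph_iso (derived_graph (@Bgraph U M i) psi) (@Bgraph V K i) eta.
Hypothesis eta_phi : forall u j, phi @: Bset (eta (u, j)) = Bset u.

Lemma covering_inj_face F : F \in K -> {in F &, injective phi}.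
Proof.
move=> KF; apply: (covering_inj phi_cov (covering_simplicial phi_cov KF)).
by rewrite inE KF eqxx.
Qed.

Lemma card_Bset_eta u j : #|Bset (eta (u, j))| = #|Bset u|.
Proof.
rewrite -(eta_phi u j) card_in_imset //; apply: covering_inj_face.
by case: (eta (u, j)) => [] [F /= /andP[]].
Qed.

(** A covering is injective on faces, hence preserves dimensions: the two
    sides of the bipartite graphs are not exchanged by [eta]. *)
Lemma eta_lower : exists f : face M i -> 'I_k -> face K i,
  forall x j, eta (inl x, j) = inl (f x j).
Proof.
have [|f fE] := @fin_all_exists _ (fun _ => face K i)
  (fun (p : face M i * 'I_k) F => eta (inl p.1, p.2) = inl F); last first.
  by exists (fun x j => f (x, j)) => x j; rewrite (fE (x, j)).
move=> [x j] /=; have := card_Bset_eta (inl x) j.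
case: (eta _) => F cF; first by exists F.
by have := esym cF; rewrite !card_face => /n_Sn.
Qed.

Lemma eta_upper : exists f : face M i.+1 -> 'I_k -> face K i.+1,
  forall x j, eta (inr x, j) = inr (f x j).
Proof.
have [|f fE] := @fin_all_exists _ (fun _ => face K i.+1)
  (fun (p : face M i.+1 * 'I_k) F => eta (inr p.1, p.2) = inr F); last first.
  by exists (fun x j => f (x, j)) => x j; rewrite (fE (x, j)).
move=> [x j] /=; have := card_Bset_eta (inr x) j.
case: (eta _) => F cF; last by exists F.
by have := cF; rewrite !card_face => /n_Sn.
Qed.

Lemma psi_in_group (x : face M i) (z : face M i.+1) :
  val x \subset val z -> psi (inr z) (inl x) \in Psi_group psi.
Proof.
move=> sub; rewrite (psi_assign (u := inl x) (v := inr z) sub) groupV mem_gen //.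
by apply/imsetP; exists (x, z).
Qed.

Variables (oK : {set V} -> seq V) (oM : {set U} -> seq U).
Hypotheses (oK_orient : orientation K oK) (oM_orient : orientation M oM).

(** When x is a facet of z, the lift over (z, c) contains the lift over (x, j)
    exactly if c is the image of j under psi(z, x), that is, if the (c, j)-entry
    of the permutation matrix of psi(z, x) is 1. So, up to the covering signs, the coboundary matrix of
    K is the sum of the D^g tensor P^g. *)
Lemma sgn_lift (x : face M i) j (z : face M i.+1) c :
  \sum_(g in Psi_group psi)
     D_mx_at R oM psi g (enum_rank z) (enum_rank x) * pmx R[i] g c j =
  sgn_cov R phi oK oM (Bset (eta (inr z, c))) *
    sgn_bd R oK (Bset (eta (inl x, j))) (Bset (eta (inr z, c))) *
    sgn_cov R phi oK oM (Bset (eta (inl x, j))).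
Proof.
have [f fE] := eta_lower; have [f' f'E] := eta_upper.
have adj : (val (f x j) \subset val (f' z c)) =
    (val x \subset val z) && (j == psi (inl x) (inr z) c).
  by have := eta_iso.2 (inl x, j) (inr z, c); rewrite fE f'E.
have phiF := eta_phi (inl x) j; have phiF' := eta_phi (inr z) c.
rewrite fE f'E !(Bset_inl, Bset_inr) in phiF phiF' *.
have [sub|nsub] := boolP (val x \subset val z); last first.
  rewrite sgn_bd_notin ?adj ?(negPf nsub) // mulr0 mul0r big1 // => g _.
  by rewrite D_mx_atE !enum_rankK (negPf nsub) mul0r.
have psiV := psi_assign (u := inl x) (v := inr z) sub.
have jc : (j == psi (inl x) (inr z) c) = (c == psi (inr z) (inl x) j).
  rewrite psiV; apply/eqP/eqP=> [->|->]; rewrite -cpermM ?mulVg ?mulgV cperm1 //.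
rewrite (big_only1 (psi (inr z) (inl x))) ?psi_in_group //; last first.
  by move=> g /negPf neq_g _; rewrite D_mx_atE !enum_rankK eq_sym neq_g andbF mul0r.
rewrite D_mx_atE !enum_rankK sub eqxx andbT.
rewrite mxE -jc; case: eqP => [jE|neq_j]; last first.
  rewrite mulr0 sgn_bd_notin ?mulr0 ?mul0r // adj sub.
  exact/eqP.
rewrite mulr1 -phiF -phiF'.
have [KF /eqP cF] := andP (valP (f x j)); have [KF' /eqP cF'] := andP (valP (f' z c)).
have [uF mF] := oK_orient KF; have [uF' mF'] := oK_orient KF'.
have [uG mG] := oM_orient (covering_simplicial phi_cov KF).
have [uG' mG'] := oM_orient (covering_simplicial phi_cov KF').
apply: sgn_bd_cov => //; rewrite ?cF ?cF' //; first exact: covering_inj_face.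
by rewrite adj sub jE eqxx.
Qed.

Lemma sgn_cov_sqr F : sgn_cov R phi oK oM F * sgn_cov R phi oK oM F = 1.
Proof. by rewrite /sgn_cov; case: ifP; rewrite ?mulr1 ?mulrNN ?mulr1. Qed.

Lemma invmx_Lambda : invmx (Lambda_mx R eta phi oK oM) = Lambda_mx R eta phi oK oM.
Proof.
rewrite /Lambda_mx invmx_diag => [|a]; last first.
  rewrite mxE; apply/eqP => s0; have /eqP := sgn_cov_sqr (Bset (eta_at eta a)).
  by rewrite s0 mul0r eq_sym oner_eq0.
congr diag_mx; apply/rowP=> a; rewrite !mxE /sgn_cov.
by case: ifP; rewrite ?invrN invr1.
Qed.

Variables (wK : {set V} -> R) (wM : {set U} -> R).
Hypotheses (wK_gt0 : forall F, F \in K -> 0 < wK F)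
  (wM_gt0 : forall G, G \in M -> 0 < wM G)
  (wKM : forall F, F \in K -> wK F = wM (phi @: F)).

(** Both coboundary factors of the Laplacian of K are replaced by their lifted
    form. The covering signs of the i-faces are those of Lambda, and the sign of
    the intermediate (i+1)-face occurs twice. In the first sum the tensor
    factor P^g is transposed, which gives the inverse of g. *)
Lemma relabel_Lup :
  Lambda_mx R eta phi oK oM *m relabel eta (Lup K oK wK i)
    *m invmx (Lambda_mx R eta phi oK oM) =
  (\sum_(g in Psi_group psi)
     (invmx (W_mx M wM i) *m (D_mx_at R oM psi g)^T) *t pmx R[i] (g^-1)%g) *m
  (\sum_(g in Psi_group psi)
     (W_mx M wM i.+1 *m D_mx_at R oM psi g) *t pmx R[i] g).
Proof.
have [f fE] := eta_lower; have [f' f'E] := eta_upper.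
(* The (i+1)-faces of K are enumerated by those of M and the sheets. *)
pose h (q : 'I_(#|{: face M i.+1}| * k)) :=
  let: (z, c) := mxtens_unindex q in f' (enum_val z) c.
have h_bij : bijective h.
  have h_inj : injective h.
    move=> a b; case: (mxtens_indexP a) => z c; case: (mxtens_indexP b) => z' c'.
    rewrite /h !mxtens_indexK => eq_f'.
    have : eta (inr (enum_val z), c) = eta (inr (enum_val z'), c').
      by rewrite !f'E eq_f'.
    by move=> /(bij_inj eta_iso.1)[ez ->]; rewrite (enum_val_inj ez).
  have [|g gK] := @fin_all_exists _ (fun=> 'I_(#|{: face M i.+1}| * k))
      (fun Z q => h q = Z); last by exists g => // q; apply: h_inj.
  move=> Z; have [eta' _ eta'K] := eta_iso.1.
  have := eta'K (inr Z); case: (eta' _) => [[x|z] c]; first by rewrite fE.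
  rewrite f'E => -[<-]; exists (mxtens_index (enum_rank z, c)).
  by rewrite /h mxtens_indexK enum_rankK.
rewrite invmx_Lambda /Lambda_mx mul_diag_mx mul_mx_diag.
apply/matrixP=> a b; rewrite 2!mxE.
case: (mxtens_indexP a) => x j; case: (mxtens_indexP b) => y l.
rewrite -(enum_valK x) -(enum_valK y); move: (enum_val x) (enum_val y) => {}x {}y.
rewrite !mxE /eta_at !mxtens_indexK !enum_rankK !fE /= LupE //.
rewrite (reindex h) /=; last exact: onW_bij.
rewrite mulr_sumr mulr_suml; apply: eq_bigr => q _.
case: (mxtens_indexP q) => z c.
rewrite -(enum_valK z); move: (enum_val z) => {}z.
rewrite /h mxtens_indexK enum_rankK.
have KF := (andP (valP (f x j))).1; have KF' := (andP (valP (f' z c))).1.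
have -> : wK (val (f x j)) = wM (val x).
  by have := eta_phi (inl x) j; rewrite wKM // fE => ->.
have -> : wK (val (f' z c)) = wM (val z).
  by have := eta_phi (inr z) c; rewrite wKM // f'E => ->.
have lift_x := sgn_lift x j z c; have lift_y := sgn_lift y l z c.
rewrite !fE !f'E !(Bset_inl, Bset_inr) in lift_x lift_y.
rewrite !summxE.
have -> : \sum_(g in Psi_group psi)
     ((invmx (W_mx M wM i) *m (D_mx_at R oM psi g)^T) *t pmx R[i] (g^-1)%g)
       (mxtens_index (enum_rank x, j)) (mxtens_index (enum_rank z, c)) =
   (wM (val x))%:C^-1 * \sum_(g in Psi_group psi)
     D_mx_at R oM psi g (enum_rank z) (enum_rank x) * pmx R[i] g c j.
  rewrite mulr_sumr; apply: eq_bigr => g _.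
  rewrite tensmxE invW_mx // mul_diag_mx mulrA; congr (_ * _).
    by rewrite !mxE !enum_rankK.
  rewrite !mxE; congr (nat_of_bool _)%:R; apply/eqP/eqP=> [->|->].
    by rewrite -cpermM mulgV cperm1.
  by rewrite -cpermM mulVg cperm1.
have -> : \sum_(g in Psi_group psi)
     ((W_mx M wM i.+1 *m D_mx_at R oM psi g) *t pmx R[i] g)
       (mxtens_index (enum_rank z, c)) (mxtens_index (enum_rank y, l)) =
   (wM (val z))%:C * \sum_(g in Psi_group psi)
     D_mx_at R oM psi g (enum_rank z) (enum_rank y) * pmx R[i] g c l.
  rewrite mulr_sumr; apply: eq_bigr => g _.
  rewrite tensmxE mul_diag_mx mulrA; congr (_ * _).
  by rewrite !mxE !enum_rankK.
rewrite lift_x lift_y.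
have := sgn_cov_sqr (val (f' z c)); set e := sgn_cov _ _ _ _ (val (f' z c)) => ee.
by rewrite -[LHS]mul1r -ee; ring.
Qed.
End Cover.

Theorem theorem1p5 (R : realType) (V U : finType)
    (K : scomplex V) (M : scomplex U) (phi : V -> U) (k i : nat)
    (phi_cov : kfold_covering K M phi k)
    (oK : {set V} -> seq V) (oM : {set U} -> seq U)
    (oK_orient : orientation K oK) (oM_orient : orientation M oM)
    (wK : {set V} -> R) (wM : {set U} -> R)
    (wK_gt0 : forall F, F \in K -> 0 < wK F)
    (wM_gt0 : forall G, G \in M -> 0 < wM G)
    (wKM : forall F, F \in K -> wK F = wM (phi @: F))
    (psi : Bvertex M i -> Bvertex M i -> cperm 'I_k)
    (psi_assign : perm_assignment (@Bgraph U M i) psi)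
    (eta : Bvertex M i * 'I_k -> Bvertex K i)
    (eta_iso : graph_iso (derived_graph (@Bgraph U M i) psi) (@Bgraph V K i) eta)
    (eta_phi : forall u j, phi @: Bset (eta (u, j)) = Bset u)
    (s : nat) (d : 'I_s -> nat)
    (rho : forall j, mx_representation R[i] (Psi_group psi) (d j))
    (rho_irr : forall j, mx_irreducible (rho j))
    (dk : (1 + \sum_j d j)%N = k)
    (T : 'M[R[i]]_k) (T_unit : T \in unitmx)
    (T_decomp : forall g, g \in Psi_group psi ->
      invmx T *m natural_repr R[i] (Psi_group psi) g *m T =
      castmx (dk, dk) (dsum_mx (1%:M : 'M_1) (fun j => rho j g))) :
  let m := #|{: face M i}| in
  let IT := (1%:M : 'M[R[i]]_m) *t T in
  let Lam := Lambda_mx R eta phi oK oM in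
  let D := D_mx_at R oM psi in
  let r := dsum_index (n := m) dk in
  invmx IT *m Lam *m relabel eta (Lup K oK wK i) *m invmx Lam *m IT =
  mxsub r r (dsum_mx (Lup M oM wM i) (fun j =>
    (\sum_(g in Psi_group psi)
       (invmx (W_mx M wM i) *m (D g)^T) *t rho j (g^-1)%g) *m
    (\sum_(g in Psi_group psi)
       (W_mx M wM i.+1 *m D g) *t rho j g))).
Proof.
move=> m IT Lam D r.
have psi_in := psi_in_group psi_assign.
have -> : invmx IT *m Lam *m relabel eta (Lup K oK wK i) *m invmx Lam *m IT =
    invmx IT *m (Lam *m relabel eta (Lup K oK wK i) *m invmx Lam) *m IT.
  by rewrite !mulmxA.
rewrite (relabel_Lup phi_cov.1 psi_assign eta_iso eta_phi oK_orient oM_orient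
  wK_gt0 wM_gt0 wKM).
set X := (X in _ *m (X *m _) *m _); set Y := (Y in _ *m (X *m Y) *m _).
(* Inserting T and its inverse in the intermediate space of (i+1)-faces
   conjugates each of the two factors separately. *)
pose IT' : 'M_(#|{: face M i.+1}| * k) := 1%:M *t T.
have IT'V : IT' *m (1%:M *t invmx T) = 1%:M.
  by rewrite tensmx_mul mulmx1 mulmxV // tensmx11.
have -> : invmx IT *m (X *m Y) *m IT =
    (invmx IT *m X *m IT') *m ((1%:M *t invmx T) *m Y *m IT).
  rewrite !mulmxA; do 2 congr (_ *m _).
  by rewrite -[RHS]mulmxA IT'V mulmx1.
rewrite /IT invmx_tens1 // /IT'.
rewrite (conj_tens_sum (rho := rho) _ T_decomp) => [|g]; last by rewrite groupV.
rewrite (conj_tens_sum (rho := rho) (h := id) _ T_decomp) //.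
rewrite mulmx_mxsub_bij; last exact: dsum_index_bij.
rewrite mul_rdsum; congr (mxsub _ _ (block_mx _ 0 0 _)).
rewrite /Lup -(D_mx_at_sum R oM psi_in) -!mulmx_sumr.
by rewrite [(\sum_(g in _) _)^T]linear_sum !mulmxA.
Qed.
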